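(* Let $H$ be a complex separable Hilbert space and let $\{(x_k, y_k)\}_{k=1}^\infty$ be an unconditional Schauder frame in $H$, i.e. $x_k, y_k \in H$ and for every $u\in H$ the series $\sum_{k=1}^\infty \langle u, y_k\rangle x_k$ converges unconditionally in $H$ and has sum $u$. Then there exists a sequence of nonzero complex numbers $\{\alpha_k\}_{k=1}^\infty\subset\mathbb{C}$ such that both $\{\alpha_k x_k\}_{k=1}^\infty$ and $\{\overline{\alpha}_k^{-1}y_k\}_{k=1}^\infty$ are frames in $H$.
   Context: The inner product $\langle\cdot,\cdot\rangle$ is linear in the first argument and conjugate-linear in the second. A sequence $\{z_k\}_{k=1}^\infty$ in $H$ is called a frame in $H$ if there exist constants $C, c>0$ such that $c\|u\|^2\leqslant \sum_{k=1}^\infty |\langle u, z_k\rangle|^2\leqslant C\|u\|^2$ for every $u\in H$. *)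

(* Defs.v *)
From HB Require Import structures.
From mathcomp Require Import all_boot all_order all_algebra.
From mathcomp Require Import complex.
From mathcomp Require Import all_classical all_reals all_analysis.

Set Implicit Arguments.
Unset Strict Implicit.
Unset Printing Implicit Defensive.

Import Order.TTheory GRing.Theory Num.Theory.
Import numFieldNormedType.Exports.

Local Open Scope classical_set_scope.
Local Open Scope ring_scope.
Local Open Scope complex_scope.

Definition separable (T : topologicalType) : Prop :=
  exists2 A : set T, countable A & dense A.

(* Over [R[i]] the norm takes its values in [R[i]]; it is always of the form
   [r%:C], and [rnorm] is that real [r]. *)
Definition rnorm (R : rcfType) (V : normedZmodType R[i]) (v : V) : R :=
  complex.Re `|v|.

Definition unconditionally_cvg (K : numFieldType) (V : normedModType K)
    (f : nat -> V) : Prop :=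
  forall sigma : nat -> nat, bijective sigma ->
    cvg (series (f \o sigma) @ \oo).

Section Frames.
Context (R : realType) (H : normedModType R[i]) (ip : H -> H -> R[i]).

Definition unconditional_schauder_frame (x y : nat -> H) : Prop :=
  forall u : H,
    unconditionally_cvg (fun k => ip u (y k) *: x k) /\
    series (fun k => ip u (y k) *: x k) @ \oo --> u.

(* The sum is taken in [\bar R], so the upper bound carries its convergence. *)
Definition frame (z : nat -> H) : Prop :=
  exists c C : R, [/\ 0 < c, 0 < C & forall u : H,
    ((c * rnorm u ^+ 2)%:E <=
       \sum_(0 <= k <oo) (rnorm (ip u (z k)) ^+ 2)%:E)%E /\
    (\sum_(0 <= k <oo) (rnorm (ip u (z k)) ^+ 2)%:E <=
       (C * rnorm u ^+ 2)%:E)%E].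

End Frames.

(* Main.v *)
(* Unconditional convergence gives
     sum_k |<u, x_k>| |<v, y_k>| <= K |u| |v|
   by rearrangement and the uniform boundedness principle.  Averaging this over
   random signs and using Khinchine's inequality yields, for finite families
   (u_i) and (v_j),
     sum_k sqrt (P_k Q_k) <= 2 K (sum_i |u_i|^2 + sum_j |v_j|^2)
   where P_k = sum_i |<u_i, x_k>|^2 and Q_k = sum_j |<v_j, y_k>|^2.  Since
   2 sqrt (P_k Q_k) is the minimum over w_k of e^{w_k} P_k + e^{- w_k} Q_k,
   weights w exist for every finite family, and a minimax argument on a compact
   product of intervals provides one w that works for all pairs (u, v).  Then
   alpha_k = e^{w_k / 2} turns both sequences into Bessel sequences, and the
   reconstruction formula turns each upper bound into a lower bound for the
   other sequence. *)

Require Import Defs.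
From HB Require Import structures.
From mathcomp Require Import all_boot all_order all_algebra.
From mathcomp Require Import complex.
From mathcomp Require Import all_classical all_reals all_analysis.

From mathcomp Require Import finmap ring lra zify.

Set Implicit Arguments.
Unset Strict Implicit.
Unset Printing Implicit Defensive.

Import Order.TTheory GRing.Theory Num.Theory.
Import numFieldNormedType.Exports.

Local Open Scope classical_set_scope.
Local Open Scope ring_scope.
Local Open Scope complex_scope.

(** * Absolute summability from convergence of all rearrangements *)

(* If the positive terms had an infinite sum, cut nat into consecutive blocks in
   each of which they add up to at least 1, and list them first in every block. *)
Lemma rearranged_Cauchy_pos_bounded (R : realType) (a : nat -> R) :
  (forall sigma : nat -> nat, bijective sigma ->
     exists N, forall m n, (N <= m <= n)%N ->
       `|\sum_(m <= k < n) a (sigma k)| < 1) ->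
  exists M, forall n, \sum_(0 <= k < n | 0 < a k) a k <= M.
Proof.
move=> cauchy_a; apply: contrapT => /forallNP unbounded.
have tail n : exists m, (n < m)%N /\ 1 <= \sum_(n <= k < m | 0 < a k) a k.
  have /existsNP[m /negP] := unbounded (1 + \sum_(0 <= k < n | 0 < a k) a k).
  rewrite -ltNge => big_m.
  have mono p q : (p <= q)%N ->
      \sum_(0 <= k < p | 0 < a k) a k <= \sum_(0 <= k < q | 0 < a k) a k.
    move=> pq; rewrite [X in _ <= X](big_cat_nat (n:=p))//= lerDl.
    by apply: sumr_ge0 => k /ltW.
  have nm : (n < m)%N.
    by rewrite ltnNge; apply/negP => /mono; lra.
  exists m; split=> //; move: big_m.
  by rewrite [X in _ < X](big_cat_nat (n:=n))//= ?(ltnW nm)//; lra.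
have {tail}[h /all_and2[hgt hsum]] := choice tail.
pose pos n := [seq k <- index_iota n (h n) | 0 < a k].
pose blk n := pos n ++ [seq k <- index_iota n (h n) | ~~ (0 < a k)].
(* Each [s j] is a permutation of the integers below its size, so the next block starts exactly at
   that size. *)
pose s := fix s j := if j is j'.+1 then s j' ++ blk (size (s j')) else [::].
have size_blk n : size (blk n) = (h n - n)%N.
  by rewrite size_cat !size_filter count_predC size_iota.
have perm_s j : perm_eq (s j) (iota 0 (size (s j))).
  elim: j => // j IH /=; rewrite size_cat iotaD perm_cat// add0n size_blk.
  by rewrite /blk /pos perm_filterC.
have size_s j : (size (s j) < size (s j.+1))%N.
  by rewrite /= size_cat size_blk; have := hgt (size (s j)); lia.
have ge_s j : (j <= size (s j))%N.
  by elim: j => // j /leq_ltn_trans; apply.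
have prefix_s i j : (i <= j)%N -> exists t, s j = s i ++ t.
  elim: j => [|j IH]; first by rewrite leqn0 => /eqP->; exists [::].
  rewrite leq_eqVlt => /predU1P[->|]; first by exists [::]; rewrite cats0.
  by move=> /IH[t st]; exists (t ++ blk (size (s j))); rewrite catA -st.
have nth_s i j k : (k < size (s i))%N -> (i <= j)%N ->
    nth 0%N (s j) k = nth 0%N (s i) k.
  by move=> ki /prefix_s[t ->]; rewrite nth_cat ki.
have mem_s j k : (k \in s j) = (k < size (s j))%N.
  by rewrite (perm_mem (perm_s j)) mem_iota.
have uniq_s j : uniq (s j) by rewrite (perm_uniq (perm_s j)) iota_uniq.
(* The lists extend one another and [s k.+1] has more than [k] entries. This therefore reads entry
   [k] of the infinite concatenation, and the default [0%N] is never returned. *)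
pose sigma k := nth 0%N (s k.+1) k.
have sigmaE j k : (k < size (s j))%N -> sigma k = nth 0%N (s j) k.
  move=> kj; rewrite /sigma; have [le|/ltnW le] := leqP k.+1 j.
    by rewrite (nth_s k.+1 j)// ge_s.
  exact: (nth_s j k.+1).
have bij : bijective sigma.
  exists (fun m => index m (s m.+1)) => [k|m].
    have lt : (sigma k < size (s k.+1))%N.
      by rewrite -mem_s /sigma mem_nth// ge_s.
    set m := sigma k; pose j := maxn k.+1 m.+1.
    have kj : (k < size (s j))%N by apply: leq_trans (ge_s _); rewrite leq_maxl.
    have [t st] := prefix_s m.+1 j (leq_maxr _ _).
    have mm : m \in s m.+1 by rewrite mem_s ge_s.
    have -> : index m (s m.+1) = index m (s j) by rewrite [in RHS]st [RHS]index_cat mm.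
    by rewrite /m (sigmaE j)// index_uniq.
  have mm : m \in s m.+1 by rewrite mem_s ge_s.
  by rewrite (sigmaE m.+1) ?index_mem// nth_index.
have [N cN] := cauchy_a _ bij.
(* Right after the first [n >= N] positions, [sigma] lists the positive terms of one block. Their
   sum is at least 1, against the Cauchy bound. *)
set n := size (s N); have := cN n (n + size (pos n))%N.
rewrite ge_s leq_addr => /(_ isT); apply/negP; rewrite -leNgt.
apply: le_trans (hsum n) (le_trans _ (ler_norm _)).
have -> : \sum_(n <= k < n + size (pos n)) a (sigma k) =
    \sum_(0 <= k < size (pos n)) a (sigma (k + n)%N).
  by rewrite -{1}[n]add0n big_addn addKn.
rewrite -big_filter -/(pos n) (big_nth 0%N) le_eqVlt; apply/orP; left.
apply/eqP; apply: eq_big_nat => i /andP[_ ip]; rewrite (sigmaE N.+1).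
  by rewrite /= nth_cat -/n ltnNge leq_addl/= addnK /blk nth_cat ip.
by rewrite /= size_cat -/n addnC ltn_add2l size_cat ltn_addr.
Qed.

Lemma rearranged_Cauchy_abs_bounded (R : realType) (a : nat -> R) :
  (forall sigma : nat -> nat, bijective sigma ->
     exists N, forall m n, (N <= m <= n)%N ->
       `|\sum_(m <= k < n) a (sigma k)| < 1) ->
  exists M, forall n, \sum_(0 <= k < n) `|a k| <= M.
Proof.
move=> ca; have [M1 HM1] := rearranged_Cauchy_pos_bounded ca.
have [|M2 HM2] := @rearranged_Cauchy_pos_bounded R (fun k => - a k).
  move=> sigma /ca[N HN]; exists N => m n /HN.
  by rewrite sumrN normrN.
exists (M1 + M2) => n; apply: le_trans (lerD (HM1 n) (HM2 n)).
rewrite [X in _ <= X + _]big_mkcond [X in _ <= _ + X]big_mkcond -big_split/=.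
apply: ler_sum => k _; rewrite oppr_gt0; case: (ltgtP (a k) 0) => [h|h|->].
- by rewrite ltr0_norm// add0r.
- by rewrite gtr0_norm// addr0.
- by rewrite normr0 addr0.
Qed.

(** * Averages over random signs and Khinchine's inequality *)

(** The expectation of [f] at [v] plus a sum of the elements of [l] with independent fair signs. The
    base point [v] is what moves in the inductions on [l]. *)
Fixpoint sign_mean (R : realType) (V : zmodType) (l : seq V) (f : V -> R)
    (v : V) : R :=
  if l is a :: l' then (sign_mean l' f (v + a) + sign_mean l' f (v - a)) / 2
  else f v.

Lemma sign_mean_le (R : realType) (V : zmodType) (l : seq V) (f g : V -> R) v :
  (forall w, f w <= g w) -> sign_mean l f v <= sign_mean l g v.
Proof.
move=> fg; elim: l v => //= a l IH v.
by rewrite ler_pM2r ?invr_gt0//; apply: lerD.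
Qed.

Lemma sign_mean0 (R : realType) (V : zmodType) (l : seq V) v :
  sign_mean l (fun=> 0 : R) v = 0.
Proof. by elim: l v => //= a l IH v; rewrite !IH addr0 mul0r. Qed.

Lemma sign_meanD (R : realType) (V : zmodType) (l : seq V) (f g : V -> R) v :
  sign_mean l (fun w => f w + g w) v = sign_mean l f v + sign_mean l g v.
Proof. by elim: l v => //= a l IH v; rewrite !IH; ring. Qed.

Lemma sign_meanZ (R : realType) (V : zmodType) (l : seq V) (c : R) (f : V -> R) v :
  sign_mean l (fun w => c * f w) v = c * sign_mean l f v.
Proof. by elim: l v => //= a l IH v; rewrite !IH; ring. Qed.

Lemma sign_mean_cst (R : realType) (V : zmodType) (l : seq V) (c : R) v :
  sign_mean l (fun=> c) v = c.
Proof. by elim: l v => //= a l IH v; rewrite !IH; field. Qed.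

Lemma sign_mean_sum (R : realType) (V : zmodType) (l : seq V) (I : Type)
    (r : seq I) (F : I -> V -> R) v :
  sign_mean l (fun w => \sum_(i <- r) F i w) v =
  \sum_(i <- r) sign_mean l (F i) v.
Proof.
elim: r => [|i r IH]; last first.
  rewrite big_cons -IH -sign_meanD; congr sign_mean.
  by apply/funext => w; rewrite big_cons.
rewrite big_nil -[RHS](sign_mean0 R l v); congr sign_mean.
by apply/funext => w; rewrite big_nil.
Qed.

(** The parallelogram law makes second moments of random signed sums additive. It will be used for
    [rnorm] on [H] and for the modulus of the inner product with a fixed vector. *)
Definition euclidean_seminorm (R : realType) (V : zmodType) (f : V -> R) :=
  [/\ forall v, 0 <= f v, forall u v, f (u + v) <= f u + f v &
      forall u v, f (u + v) ^+ 2 + f (u - v) ^+ 2 = 2 * (f u ^+ 2 + f v ^+ 2)].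

Lemma euclidean_seminorm0 (R : realType) (V : zmodType) (f : V -> R) :
  euclidean_seminorm f -> f 0 = 0.
Proof.
move=> [_ _ /(_ 0 0)]; rewrite addr0 subr0 => h.
by apply/eqP; rewrite -sqrf_eq0; apply/eqP; lra.
Qed.

Lemma sign_mean_sqr (R : realType) (V : zmodType) (f : V -> R) (l : seq V) v :
  euclidean_seminorm f ->
  sign_mean l (fun w => f w ^+ 2) v = f v ^+ 2 + \sum_(a <- l) f a ^+ 2.
Proof.
move=> [_ _ fP]; elim: l v => [|a l IH] v /=; first by rewrite big_nil addr0.
rewrite !IH big_cons; set S := \sum_(_ <- _) _.
by have := fP v a; lra.
Qed.

(** The right side is shaped so that the induction closes: with [p = f v ^+ 2] and [q = f a ^+ 2],
    averaging over the sign of [a] costs at most [p ^+ 2 + 6 * p * q + q ^+ 2], and the slack left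
    is [2 * q ^+ 2]. *)
Lemma sign_mean_pow4_le (R : realType) (V : zmodType) (f : V -> R) (l : seq V) v :
  euclidean_seminorm f ->
  let S := \sum_(a <- l) f a ^+ 2 in
  sign_mean l (fun w => f w ^+ 4) v <=
  f v ^+ 4 + 6 * f v ^+ 2 * S + 3 * S ^+ 2.
Proof.
move=> [f0 fD fP]; elim: l v => [|a l IH] v /=.
  by rewrite big_nil expr0n/= !mulr0 !addr0.
rewrite big_cons; set S := \sum_(_ <- _) _ in IH *.
have S0 : 0 <= S by apply: sumr_ge0 => i _; rewrite sqr_ge0.
have := lerD (IH (v + a)) (IH (v - a)).
set A := f (v + a); set B := f (v - a).
have hP : A ^+ 2 + B ^+ 2 = _ := fP v a.
have A0 : 0 <= A := f0 _; have B0 : 0 <= B := f0 _.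
have hA : A ^+ 2 <= (f v + f a) ^+ 2.
  by rewrite ler_pXn2r ?nnegrE ?addr_ge0//; exact: fD.
have hB : B ^+ 2 <= (f v + f a) ^+ 2.
  rewrite ler_pXn2r ?nnegrE ?addr_ge0// /B.
  apply: le_trans (fD _ _) _; rewrite lerD2l.
  (* The parallelogram law at [0] and [a] yields [f (- a) = f a]. *)
  have := fP 0 a; rewrite sub0r add0r (euclidean_seminorm0 (And3 f0 fD fP)) => h.
  by rewrite -(@ler_pXn2r _ 2)// ?nnegrE//; lra.
(* Both squares are at most [(f v + f a) ^+ 2]. Their sum being fixed, both are at least
   [(f v - f a) ^+ 2], so they differ by at most [4 * (f v * f a)]. *)
have hAB : (A ^+ 2 - B ^+ 2) ^+ 2 <= 16 * (f v ^+ 2 * f a ^+ 2).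
  have -> : 16 * (f v ^+ 2 * f a ^+ 2) = (4 * (f v * f a)) ^+ 2 by ring.
  rewrite -subr_ge0 subr_sqr mulr_ge0//.
    by lra.
  by lra.
have h4 : A ^+ 4 + B ^+ 4 =
    ((A ^+ 2 + B ^+ 2) ^+ 2 + (A ^+ 2 - B ^+ 2) ^+ 2) / 2 by field.
move=> h; rewrite ler_pdivrMr//; apply: (le_trans h).
have -> : A ^+ 4 + 6 * A ^+ 2 * S + 3 * S ^+ 2 +
  (B ^+ 4 + 6 * B ^+ 2 * S + 3 * S ^+ 2) =
  (A ^+ 4 + B ^+ 4) + 6 * (A ^+ 2 + B ^+ 2) * S + 6 * S ^+ 2 by ring.
rewrite h4 hP.
have : 0 <= f a ^+ 4 by rewrite exprn_ge0.
have -> : f v ^+ 4 = (f v ^+ 2) ^+ 2 by ring.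
have -> : f a ^+ 4 = (f a ^+ 2) ^+ 2 by ring.
set p := f v ^+ 2; set q := f a ^+ 2; move: hAB; rewrite -/p -/q; nra.
Qed.

(** The first moment is bounded below by the second and fourth ones, through a pointwise inequality
    between [f w], [f w ^+ 2] and [f w ^+ 4] that is averaged over the signs. *)
Lemma Khinchine (R : realType) (V : zmodType) (f : V -> R) (l : seq V) :
  euclidean_seminorm f ->
  Num.sqrt (\sum_(a <- l) f a ^+ 2) <= 2 * sign_mean l f 0.
Proof.
move=> fE; have [f0 fD fP] := fE.
set S := \sum_(_ <- _) _; set s := Num.sqrt S; set m := sign_mean l f 0.
have S0 : 0 <= S by apply: sumr_ge0 => i _; rewrite sqr_ge0.
have s0 : 0 <= s := sqrtr_ge0 _.
have sS : s ^+ 2 = S by rewrite sqr_sqrtr.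
have m0 : 0 <= m by rewrite -(sign_mean0 R l 0); apply: sign_mean_le.
have [->|sn0] := eqVneq s 0; first by rewrite mulr_ge0.
have sp : 0 < s by rewrite lt_def sn0.
(* (t - 2)^2 (t + 4) >= 0 at t = f w / s *)
have pt w : 12 * s ^+ 2 * f w ^+ 2 + (-1) * f w ^+ 4 <= 16 * s ^+ 3 * f w.
  have : 0 <= f w * ((f w - 2 * s) ^+ 2 * (f w + 4 * s)).
    apply: mulr_ge0 => //; apply: mulr_ge0; first exact: sqr_ge0.
    by rewrite addr_ge0// mulr_ge0.
  by lra.
have := sign_mean_le l 0 pt.
rewrite sign_meanD !sign_meanZ sign_mean_sqr// -/S -/m.
have := sign_mean_pow4_le l 0 fE; rewrite /= -/S (euclidean_seminorm0 fE).
rewrite !expr0n/= add0r mulr0 mul0r add0r -sS => h4 h.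
(* The averaged inequality reads [12 * s ^+ 4 - 3 * s ^+ 4 <= 16 * s ^+ 3 * m]; the constant
   [16 / 9] is then rounded up to 2. *)
have : 0 <= s ^+ 3 * (16 * m - 9 * s).
  by lra.
by rewrite pmulr_rge0 ?exprn_gt0//; lra.
Qed.

(** * A minimax principle for convex functions on a compact set *)

Section Minimax.
Variables (R : realType) (X : ptopologicalType) (T : set X).
Variables (comb : R -> X -> X -> X) (I : choiceType) (f : I -> X -> R).
Hypothesis T_compact : compact T.
Hypothesis f_continuous : forall i, continuous (f i).
Hypothesis combT : forall h s t, 0 <= h <= 1 -> T s -> T t -> T (comb h s t).
Hypothesis f_convex : forall i h s t, 0 <= h <= 1 -> T s -> T t ->
  f i (comb h s t) <= (1 - h) * f i s + h * f i t.

(* At a minimiser of the sum of the squares of the positive parts of the [f i],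
   these positive parts are the weights to which the hypothesis is applied. *)
Lemma finite_minimax (l : seq I) :
  (forall lam : I -> R, (forall i, 0 <= lam i) ->
    exists2 t, T t & \sum_(i <- l) lam i * f i t <= 0) ->
  exists2 t, T t & forall i, i \in l -> f i t <= 0.
Proof.
move=> weighted; have [//|t0 Tt0 _] := weighted (fun=> 0).
pose p i t := Num.max 0 (f i t); pose G t := \sum_(i <- l) p i t ^+ 2.
have cG : continuous G.
  rewrite /G; elim: (l) => [|i r IH] t.
    by under eq_fun do rewrite big_nil; exact: cst_continuous.
  under eq_fun do rewrite big_cons.
  apply: cvgD; last exact: IH.
  apply: (@continuous_comp _ _ _ (p i) (fun x => x ^+ 2)); last first.
    exact: exprn_continuous.
  by apply: continuous_max; [exact: cst_continuous|exact: f_continuous].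
have [|c Tc cmin] := compact_EVT_min _ T_compact (continuous_subspaceT cG).
  by exists t0.
move: Tc => /set_mem Tc.
have p0 i t : 0 <= p i t by rewrite le_max lexx.
have [s Ts hs] := weighted (p^~ c) (fun i => p0 i c).
pose d i := f i s - f i c.
pose D := \sum_(i <- l) d i ^+ 2.
have D0 : 0 <= D by apply: sumr_ge0 => i _; exact: sqr_ge0.
have G0 : 0 <= G c by apply: sumr_ge0 => i _; exact: sqr_ge0.
(* Since [p i c * f i c = p i c ^+ 2], the choice of [s] makes the direction from [c] to [s] a
   descent direction for [G]. *)
have pd : \sum_(i <- l) p i c * d i <= - G c.
  rewrite -subr_ge0 /G -sumrN -sumrB.
  have -> : \sum_(i <- l) (- p i c ^+ 2 - p i c * d i) =
            - \sum_(i <- l) p i c * f i s.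
    rewrite -sumrN; apply: eq_bigr => i _; rewrite /d /p.
    by case: (leP 0 (f i c)) => _; ring.
  by rewrite oppr_ge0.
(* By convexity each positive part at [comb h c s] is at most the positive part of
   [p i c + h * d i]; squaring and summing gives a quadratic in [h]. *)
have Gh h : 0 <= h <= 1 -> G c <= G c - 2 * h * G c + h ^+ 2 * D.
  move=> h01; have /andP[h0 _] := h01.
  have Tcs := combT h01 Tc Ts.
  have /le_trans -> // : G c <= G (comb h c s) by exact/cmin/mem_set.
  apply: (@le_trans _ _ (\sum_(i <- l) (p i c + h * d i) ^+ 2)).
    apply: ler_sum => i _; rewrite {1}/p.
    case: (leP 0 (f i (comb h c s))) => [fge0|_]; last first.
      by rewrite expr0n/= sqr_ge0.
    have le1 : f i (comb h c s) <= p i c + h * d i.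
      apply: le_trans (f_convex i h01 Tc Ts) _.
      have : f i c <= p i c by rewrite le_max lexx orbT.
      by rewrite /d; lra.
    by rewrite ler_pXn2r// nnegrE// (le_trans fge0).
  have -> : \sum_(i <- l) (p i c + h * d i) ^+ 2 =
     G c + 2 * h * \sum_(i <- l) p i c * d i + h ^+ 2 * D.
    rewrite /G /D 2!mulr_sumr -!big_split/=.
    by apply: eq_bigr => i _; ring.
  rewrite lerD2r -mulrN lerD2l ler_wpM2l// mulr_ge0//.
have {G0}Gc0 : G c = 0.
  apply/eqP; rewrite eq_le G0 andbT leNgt; apply/negP => Gpos.
  have GD : 0 < G c + D by rewrite ltr_wpDr.
  (* For this [h] one has [h ^+ 2 * D <= h * G c < 2 * h * G c], so [Gh] would contradict the
     minimality of [c]. *)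
  have h01 : 0 <= G c / (G c + D) <= 1.
    apply/andP; split; first by rewrite divr_ge0// ltW.
    by rewrite ler_pdivrMr// mul1r; lra.
  have := Gh _ h01; set h := _ / _.
  have hE : h * (G c + D) = G c by rewrite divfK// gt_eqF.
  have hpos : 0 < h by rewrite divr_gt0.
  by nra.
exists c => // i il; apply: le_trans (_ : p i c <= 0).
  by rewrite le_max lexx orbT.
have : p i c ^+ 2 == 0.
  move/eqP: Gc0; rewrite psumr_eq0; last by move=> j _; exact: sqr_ge0.
  by move=> /allP /(_ _ il).
by rewrite sqrf_eq0 => /eqP->.
Qed.

(** Passage from finitely many constraints to all of them by the finite intersection property of the
    closed sets where [f i <= 0] in the compact [T]. *)
Lemma minimax :
  (forall (l : seq I) (lam : I -> R), (forall i, 0 <= lam i) ->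
    exists2 t, T t & \sum_(i <- l) lam i * f i t <= 0) ->
  exists2 t, T t & forall i, f i t <= 0.
Proof.
move=> weighted; pose F i := T `&` [set t | f i t <= 0].
have [t0 Tt0 _] : exists2 t, T t & \sum_(i <- [::]) 0 * f i t <= 0.
  exact: (weighted [::] (fun=> 0)).
(* The extra index [None] stands for [T] itself and places the common point in [T] even when [I] is
   empty. *)
have [] : \bigcap_(i in [set: option I]) (if i is Some j then F j else T) !=set0.
  move: T_compact; rewrite compact_In0; apply.
    exists (fun i => if i is Some j then [set t | f j t <= 0] else setT).
      move=> [i|] _; last exact: closedT.
      apply: (@closed_comp _ _ (f i) [set x | x <= 0]); last exact: closed_le.
      by move=> t _; exact: f_continuous.
    by move=> [i|] _ //; rewrite setIT.
  move=> D' _; have [|t Tt tP] := @finite_minimax (pmap id (enum_fset D')).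
    exact: weighted.
  exists t => -[i|] iD //; split => //=.
  by apply: tP; rewrite mem_pmap map_id.
move=> t tP; exists t; first exact: (tP None).
by move=> i; have [] := tP (Some i) Logic.I.
Qed.

End Minimax.

(** * Real-valued norms over the complex field *)

Section ComplexNorm.
Variables (R : realType) (V : normedZmodType R[i]).
Implicit Types u v : V.

Lemma rnormE v : `|v| = (rnorm v)%:C.
Proof. by rewrite /rnorm RRe_real// ger0_real. Qed.

Lemma rnorm_ge0 v : 0 <= rnorm v.
Proof. by have := normr_ge0 v; rewrite rnormE lecR. Qed.

Lemma rnormD u v : rnorm (u + v) <= rnorm u + rnorm v.
Proof. by rewrite -lecR rmorphD/= -!rnormE ler_normD. Qed.

Lemma rnormN v : rnorm (- v) = rnorm v.
Proof. by rewrite /rnorm normrN. Qed.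

Lemma rnorm0 : rnorm (0 : V) = 0.
Proof. by rewrite /rnorm normr0. Qed.

Lemma rnorm_sum (I : Type) (r : seq I) (F : I -> V) :
  rnorm (\sum_(i <- r) F i) <= \sum_(i <- r) rnorm (F i).
Proof.
rewrite -lecR -rnormE raddf_sum/=; apply: le_trans (ler_norm_sum _ _ _) _.
by apply: ler_sum => i _; rewrite rnormE.
Qed.

End ComplexNorm.

Lemma rnormM (R : realType) (a b : R[i]) : rnorm (a * b) = rnorm a * rnorm b.
Proof. by apply: complexI; rewrite rmorphM/= -!rnormE normrM. Qed.

Lemma rnorm_real (R : realType) (a : R) : rnorm a%:C = `|a|.
Proof. by apply: complexI; rewrite -rnormE normc_def/= expr0n addr0 sqrtr_sqr. Qed.

Lemma rnormZ (R : realType) (V : normedModType R[i]) (a : R[i]) (v : V) :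
  rnorm (a *: v) = rnorm a * rnorm v.
Proof. by apply: complexI; rewrite rmorphM/= -!rnormE normrZ. Qed.

Lemma rnorm_sqr (R : realType) (a : R[i]) :
  (rnorm a ^+ 2)%:C = a * Num.conj a.
Proof. by rewrite rmorphXn/= -rnormE normCK. Qed.

Lemma conj_real (R : realType) (a : R) : Num.conj a%:C = a%:C.
Proof. exact: conjc_real. Qed.

Lemma gt0_real (R : realType) (e : R[i]) : 0 < e -> exists2 d : R, 0 < d & e = d%:C.
Proof.
move=> e0; have eE : e = (complex.Re e)%:C by rewrite RRe_real// gtr0_real.
by exists (complex.Re e) => //; rewrite -ltcR -eE.
Qed.

Lemma Re_le_rnorm (R : realType) (a : R[i]) : `|complex.Re a| <= rnorm a.
Proof.
rewrite -lecR -rnormE normc_def lecR /=; case: a => x y /=.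
by rewrite -sqrtr_sqr ler_wsqrtr// lerDl sqr_ge0.
Qed.

Lemma Im_le_rnorm (R : realType) (a : R[i]) : `|complex.Im a| <= rnorm a.
Proof.
rewrite -lecR -rnormE normc_def lecR /=; case: a => x y /=.
by rewrite -sqrtr_sqr ler_wsqrtr// lerDr sqr_ge0.
Qed.

Lemma rnorm_le_ReIm (R : realType) (a : R[i]) :
  rnorm a <= `|complex.Re a| + `|complex.Im a|.
Proof.
rewrite -lecR -rnormE normc_def lecR /=; case: a => x y /=.
rewrite -(@ler_pXn2r _ 2)// ?nnegrE ?addr_ge0 ?sqrtr_ge0//.
rewrite sqr_sqrtr ?addr_ge0 ?sqr_ge0// sqrrD !real_normK ?num_real//.
by rewrite lerD2r lerDl mulrn_wge0// mulr_ge0.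
Qed.

Lemma parallelogram_complex (R : realType) (a b : R[i]) :
  rnorm (a + b) ^+ 2 + rnorm (a - b) ^+ 2 = 2 * (rnorm a ^+ 2 + rnorm b ^+ 2).
Proof.
apply: complexI; rewrite rmorphM !rmorphD/= !rnorm_sqr.
by rewrite rmorphD rmorphB/=; ring.
Qed.

(** * Inner product: Cauchy-Schwarz and the parallelogram law *)

Section Hilbert.
Variables (R : realType) (H : normedModType R[i]).
Variable ip : {dot H for (@Num.conj R[i])}.
Hypothesis ip_norm : forall u : H, ip u u = `|u| ^+ 2.

Lemma ip_rnorm u : ip u u = (rnorm u ^+ 2)%:C.
Proof. by rewrite ip_norm rnormE rmorphXn. Qed.

Lemma ipC u v : ip u v = Num.conj (ip v u).
Proof. by have := hermC ip u v; rewrite /= expr0 mul1r. Qed.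

Lemma rnorm_ipC u v : rnorm (ip u v) = rnorm (ip v u).
Proof. by rewrite ipC /rnorm norm_conjC. Qed.

Lemma ipDl z u v : ip (u + v) z = ip u z + ip v z.
Proof. exact: linearDl. Qed.

Lemma ipBl z u v : ip (u - v) z = ip u z - ip v z.
Proof. exact: linearBl. Qed.

Lemma ipZl z a u : ip (a *: u) z = a * ip u z.
Proof. exact: linearZl_LR. Qed.

Lemma ip_suml z (I : Type) (r : seq I) (F : I -> H) :
  ip (\sum_(i <- r) F i) z = \sum_(i <- r) ip (F i) z.
Proof. exact: linear_sumlz. Qed.

Lemma ipDr z u v : ip z (u + v) = ip z u + ip z v.
Proof. exact: linearDr. Qed.

Lemma ipBr z u v : ip z (u - v) = ip z u - ip z v.
Proof. exact: linearBr. Qed.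

Lemma ipZr z a u : ip z (a *: u) = Num.conj a * ip z u.
Proof. exact: linearZr_LR. Qed.

Lemma Cauchy_Schwarz u v : rnorm (ip u v) <= rnorm u * rnorm v.
Proof.
have [v0|v0] := eqVneq (rnorm v) 0.
  have -> : v = 0 by apply/eqP; rewrite -normr_eq0 rnormE v0.
  by rewrite linear0r !rnorm0 mulr0.
have vp : 0 < rnorm v by rewrite lt_def v0 rnorm_ge0.
have : 0 <= rnorm v ^+ 2 * ((rnorm u * rnorm v) ^+ 2 - rnorm (ip u v) ^+ 2).
  suff -> : rnorm v ^+ 2 * ((rnorm u * rnorm v) ^+ 2 - rnorm (ip u v) ^+ 2) =
      rnorm ((rnorm v ^+ 2)%:C *: u - ip u v *: v) ^+ 2 by exact: sqr_ge0.
  apply: complexI.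
  rewrite -[RHS]ip_rnorm !(ipBl, ipBr, ipZl, ipZr) !ip_rnorm (ipC v u).
  rewrite rmorphM rmorphB/= rnorm_sqr !conj_real !rmorphXn/= !rmorphM/=.
  by ring.
rewrite pmulr_rge0 ?exprn_gt0// subr_ge0 ler_pXn2r// nnegrE ?mulr_ge0//;
  exact: rnorm_ge0.
Qed.

Lemma euclidean_seminorm_rnorm : euclidean_seminorm (@rnorm R H).
Proof.
split=> [v|u v|u v]; [exact: rnorm_ge0|exact: rnormD|].
apply: complexI; rewrite rmorphM !rmorphD/= -!ip_rnorm.
by rewrite !(ipBl, ipBr, ipDl, ipDr); ring.
Qed.

Lemma euclidean_seminorm_ip z : euclidean_seminorm (fun u => rnorm (ip u z)).
Proof.
split=> [v|u v|u v]; first exact: rnorm_ge0.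
  by rewrite ipDl; exact: rnormD.
by rewrite ipDl ipBl; exact: parallelogram_complex.
Qed.

End Hilbert.

(** * Completeness and the uniform boundedness principle *)

Lemma cvg_series_Cauchy (R : realType) (V : normedModType R[i]) (f : nat -> V) :
  cvg (series f @ \oo) -> forall e : R, 0 < e ->
  exists N, forall m n, (N <= m <= n)%N -> rnorm (\sum_(m <= k < n) f k) < e.
Proof.
move=> /cvgrPdist_lt cf e e0.
have e20 : 0 < (e / 2)%:C :> R[i] by rewrite ltcR divr_gt0.
have [N _ hN] := cf _ e20; exists N => m n /andP[Nm mn].
have := lerD (ltW (hN m Nm)) (ltW (hN n (leq_trans Nm mn))).
have hm := hN m Nm; have hn := hN n (leq_trans Nm mn).
rewrite -sub_series_geq//; set l := lim _ in hm hn *.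
have -> : series f n - series f m = (l - series f m) + - (l - series f n).
  by rewrite opprB [RHS]addrC subrKA.
move: hm hn; rewrite /= !rnormE !ltcR => hm hn _.
by apply: le_lt_trans (rnormD _ _) _; rewrite rnormN; lra.
Qed.

(** The second hypothesis nests the closed balls of centre [c n] and radius [r n]. The radii tend to
    0, so the centres are Cauchy and their limit lies in every ball. *)
Lemma nested_balls (R : realType) (H : completeNormedModType R[i])
    (c : nat -> H) (r : nat -> R) :
  (forall n, 0 < r n <= n.+1%:R^-1) ->
  (forall n, rnorm (c n.+1 - c n) + r n.+1 <= r n) ->
  exists z, forall n, rnorm (z - c n) <= r n.
Proof.
move=> rP cP.
have dist m n : (m <= n)%N -> rnorm (c n - c m) <= r m.
  move=> mn; apply: (@le_trans _ _ (r m - r n)); last first.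
    by have /andP[] := rP n; lra.
  elim: n mn => [|n IH].
    by rewrite leqn0 => /eqP->; rewrite !subrr rnorm0.
  rewrite leq_eqVlt => /predU1P[->|/IH h]; first by rewrite !subrr rnorm0.
  have -> : c n.+1 - c m = (c n.+1 - c n) + (c n - c m) by rewrite subrKA.
  by apply: le_trans (rnormD _ _) _; have := cP n; lra.
have : cvg (c @ \oo).
  apply: cauchy_cvg; apply: cauchy_exP => e /gt0_real[d d0 ->].
  have [n nd] : exists n : nat, n.+1%:R^-1 < d.
    exists (Num.trunc d^-1).
    by rewrite invf_plt ?posrE// truncnS_gt.
  exists (c n), n => // m nm; rewrite -ball_normE /ball_/= rnormE ltcR.
  rewrite -rnormN opprB; apply: le_lt_trans (dist _ _ nm) _.
  by apply: le_lt_trans nd; have /andP[] := rP n.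
set z := lim _ => /cvgrPdist_lt cz; exists z => n.
apply/ler_addgt0Pl => e e0.
have e0C : 0 < e%:C :> R[i] by rewrite ltcR.
have [N _ hN] := cz _ e0C; have := hN (maxn N n) (leq_maxl _ _).
rewrite /= rnormE ltcR => h.
have -> : z - c n = (z - c (maxn N n)) + (c (maxn N n) - c n) by rewrite subrKA.
apply: le_trans (rnormD _ _) (lerD (ltW h) (dist _ _ (leq_maxr _ _))).
Qed.

(** If no uniform bound existed, one could choose nested balls on which some [p i] exceeds any
    prescribed integer; their common point would violate the pointwise bound. *)
Lemma seminorm_uniform_bound (R : realType) (H : completeNormedModType R[i])
    (I : Type) (p : I -> H -> R) :
  (forall i u v, p i (u + v) <= p i u + p i v) ->
  (forall i (a : R) u, p i (a%:C *: u) = `|a| * p i u) ->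
  (forall i, exists L, forall u, p i u <= L * rnorm u) ->
  (forall u, exists M, forall i, p i u <= M) ->
  exists2 K, 0 <= K & forall i u, p i u <= K * rnorm u.
Proof.
move=> pD pZ pL pM.
have pN i u : p i (- u) = p i u.
  by have := pZ i (-1) u; rewrite rmorphN rmorph1 scaleN1r normrN1 mul1r.
apply: contrapT => unb.
have {}unb K : exists i u, K * rnorm u < p i u.
  apply: contrapT => /forallNP hK; apply: unb; exists (Num.max 0 K).
    by rewrite le_max lexx.
  move=> i u; rewrite leNgt; apply/negP => h; apply: (hK i); exists u.
  apply: le_lt_trans h; rewrite ler_wpM2r ?rnorm_ge0//.
  by rewrite le_max lexx orbT.
(* Gliding hump: [p i w <= max (p i (x + w)) (p i (x - w))], so that some [p i]
   is large on a ball inside any given ball. *)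
have step (s : nat * (H * R)) : exists t : H * R, 0 < s.2.2 ->
    [/\ 0 < t.2 <= s.1.+2%:R^-1, rnorm (t.1 - s.2.1) + t.2 <= s.2.2 &
        exists i, forall z, rnorm (z - t.1) <= t.2 -> s.1%:R <= p i z].
  case: s => n [x r] /=; have [r0|] := ltP 0 r; last first.
    by move=> _; exists (x, r).
  (* With this constant, rescaling [u] to norm [r / 2] gives a vector [w] with [p i w >= n.+1]. *)
  have [i [u]] := unb (2 * n.+1%:R / r); set K := _ / _ => Ku.
  have [L hL] := pL i.
  have u0 : 0 < rnorm u.
    rewrite lt_def rnorm_ge0 andbT; apply/negP => /eqP u0.
    by have := hL u; move: Ku; rewrite u0 !mulr0; lra.
  have c0 : 0 < r / 2 / rnorm u by rewrite !divr_gt0.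
  pose w := (r / 2 / rnorm u)%:C *: u.
  have wr : rnorm w = r / 2.
    by rewrite rnormZ rnorm_real gtr0_norm// divfK// gt_eqF.
  have pw : n.+1%:R <= p i w.
    rewrite pZ gtr0_norm//.
    have -> : n.+1%:R = r / 2 / rnorm u * (K * rnorm u).
      by rewrite /K; field; rewrite !gt_eqF.
    by rewrite ler_pM2l// ltW.
  have [x' x'r px'] : exists2 x', rnorm (x' - x) = r / 2 & n.+1%:R <= p i x'.
    have [h|h] := leP (n.+1%:R) (p i (x + w)).
      by exists (x + w) => //; rewrite addrC addKr.
    exists (x - w); first by rewrite addrC addKr rnormN.
    have := pD i (x + w) (- (x - w)); rewrite pN.
    have -> : x + w + - (x - w) = 2%:C *: w.
      rewrite opprB [x + w]addrC addrACA subrr addr0.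
      by rewrite rmorphD rmorph1 scalerDl scale1r.
    by rewrite pZ ger0_norm//; lra.
  (* A positive Lipschitz constant for [p i]: within radius [L'^-1] the value drops by at most 1,
     from [n.+1] to [n]. *)
  pose L' := Num.max 0 L + 1.
  have L'0 : 0 < L' by rewrite ltr_wpDl// le_max lexx.
  pose r' := Num.min (r / 2) (Num.min L'^-1 n.+2%:R^-1).
  have r'0 : 0 < r' by rewrite !lt_min divr_gt0// !invr_gt0 L'0/=.
  exists (x', r') => _ /=; split.
  - by rewrite r'0 /r' !ge_min lexx !orbT.
  - rewrite x'r; have : r' <= r / 2 by rewrite ge_min lexx.
    by lra.
  - exists i => z zr.
    have r'L : L' * r' <= 1.
      rewrite mulrC -ler_pdivlMr// div1r.
      by rewrite /r' !ge_min lexx !orbT.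
    have h1 : L * rnorm (x' - z) <= L' * r'.
      apply: (@le_trans _ _ (L' * rnorm (x' - z))).
        rewrite ler_wpM2r ?rnorm_ge0//.
        have : L <= Num.max 0 L by rewrite le_max lexx orbT.
        by rewrite /L'; lra.
      by rewrite ler_wpM2l ?(ltW L'0)// -rnormN opprB.
    have := pD i z (x' - z); rewrite addrC subrK.
    have := hL (x' - z); move: px'; rewrite -natr1; lra.
have [F FP] := choice step.
pose st := fix st n := if n is m.+1 then F (m, st m) else (0, 1 : R).
have st0 n : 0 < (st n).2.
  by elim: n => //= n IH; have [/andP[]] := FP (n, st n) IH.
have [|n|z zP] := @nested_balls R H (fun n => (st n).1) (fun n => (st n).2).
- case=> [|n]; first by rewrite /= ltr01 invr1 lexx.
  by have [] := FP (n, st n) (st0 n).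
- by have [] := FP (n, st n) (st0 n).
have [M hM] := pM z; pose n := (Num.trunc M).+1.
have [_ _ [i hi]] := FP (n, st n) (st0 n).
have := le_trans (hi z (zP n.+1)) (hM i).
by rewrite leNgt truncnS_gt.
Qed.

(** * Continuity on the product space of weight sequences *)

HB.instance Definition _ (R : realType) :=
  isPointed.Build {ptws nat -> R} (fun=> 0).

Lemma continuous_sum_proj (R : realType) (g : nat -> R -> R) n :
  (forall k, continuous (g k)) ->
  continuous (fun w : {ptws nat -> R} => \sum_(0 <= k < n) g k (w k)).
Proof.
move=> gC; elim: n => [|n IH] w.
  have -> : (fun w : {ptws nat -> R} => \sum_(0 <= k < 0) g k (w k)) = cst 0.
    by apply/funext => w'; rewrite big_nil.
  exact: cst_continuous.
have -> : (fun w : {ptws nat -> R} => \sum_(0 <= k < n.+1) g k (w k)) =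
    (fun w => \sum_(0 <= k < n) g k (w k) + g n (w n)).
  by apply/funext => w'; rewrite big_nat_recr.
apply: (@continuousD R R {ptws nat -> R} (fun w => \sum_(0 <= k < n) g k (w k))
  (fun w => g n (w n))); first exact: IH.
apply: (@continuous_comp {ptws nat -> R} R R (fun w => w n) (g n)).
  exact: (@proj_continuous nat (fun=> R)).
exact: gC.
Qed.

Lemma continuous_expR_balance (R : realType) (p q : R) :
  continuous (fun a : R => expR a * p + expR (- a) * q).
Proof.
move=> a; apply: cvgD; apply: cvgM; try exact: cvg_cst.
  exact: continuous_expR.
apply: (@continuous_comp R R R -%R expR); last exact: continuous_expR.
exact: oppr_continuous.
Qed.

(** * Construction of the weights *)

Section Weights.
Variables (R : realType) (H : normedModType R[i]).
Variable ip : {dot H for (@Num.conj R[i])}.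
Hypothesis ip_norm : forall u : H, ip u u = `|u| ^+ 2.

(** By Cauchy-Schwarz every rearrangement of the scalar series is Cauchy; the rearrangement
    criterion then applies to real and imaginary parts separately. *)
Lemma unconditionally_cvg_abs_bounded (f : nat -> H) v :
  unconditionally_cvg f ->
  exists M, forall n, \sum_(0 <= k < n) rnorm (ip (f k) v) <= M.
Proof.
move=> uf; have v0 : 0 < 1 + rnorm v by rewrite ltr_pwDl// rnorm_ge0.
have vlt : rnorm v / (1 + rnorm v) < 1 by rewrite ltr_pdivrMr// mul1r ltrDr.
have cauchy (g : R[i] -> R) : (forall a, `|g a| <= rnorm a) ->
    (forall (r : seq nat) F, g (\sum_(k <- r) F k) = \sum_(k <- r) g (F k)) ->
    exists M : R, forall n, \sum_(0 <= k < n) `|g (ip (f k) v)| <= M.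
  move=> gle gsum; apply: rearranged_Cauchy_abs_bounded => sigma /uf cf.
  (* This tolerance makes the scalar tails smaller than 1, also when [v = 0]. *)
  have [|N hN] := cvg_series_Cauchy cf (_ : 0 < (1 + rnorm v)^-1).
    by rewrite invr_gt0.
  exists N => m n /hN small; rewrite -gsum -(ip_suml ip v).
  apply: le_lt_trans (gle _) _; apply: le_lt_trans (Cauchy_Schwarz ip_norm _ _) _.
  apply: le_lt_trans vlt; rewrite mulrC ler_wpM2l ?rnorm_ge0// ltW//.
have [|r F|M1 h1] := cauchy (@complex.Re R).
- exact: Re_le_rnorm.
- exact: (big_morph _ (fun a b => raddfD _ a b) erefl).
have [|r F|M2 h2] := cauchy (@complex.Im R).
- exact: Im_le_rnorm.
- exact: (big_morph _ (fun a b => raddfD _ a b) erefl).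
exists (M1 + M2) => n; apply: le_trans (lerD (h1 n) (h2 n)).
by rewrite -big_split; apply: ler_sum => k _; exact: rnorm_le_ReIm.
Qed.

Variables (x y : nat -> H) (K : R).
Hypothesis K0 : 0 <= K.
Hypothesis xyK : forall n u v,
  \sum_(0 <= k < n) rnorm (ip u (x k)) * rnorm (ip v (y k)) <=
  K * (rnorm u * rnorm v).

(** Khinchine bounds each product of square roots by 4 times a double average over signed sums [u]
    of [lu] and [v] of [lv]. There [xyK] applies, [|u| |v|] is at most half of [|u|^2 + |v|^2], and
    second moments add up, whence [2 * K]. *)
Lemma square_function_bound (lu lv : seq H) n :
  \sum_(0 <= k < n) Num.sqrt (\sum_(a <- lu) rnorm (ip a (x k)) ^+ 2) *
                    Num.sqrt (\sum_(b <- lv) rnorm (ip b (y k)) ^+ 2) <=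
  2 * K * (\sum_(a <- lu) rnorm a ^+ 2 + \sum_(b <- lv) rnorm b ^+ 2).
Proof.
pose f k u := rnorm (ip u (x k)); pose g k v := rnorm (ip v (y k)).
have nE := euclidean_seminorm_rnorm ip_norm.
apply: (@le_trans _ _
    (\sum_(0 <= k < n) 4 * (sign_mean lv (g k) 0 * sign_mean lu (f k) 0))).
  apply: ler_sum => k _.
  have -> : 4 * (sign_mean lv (g k) 0 * sign_mean lu (f k) 0) =
    (2 * sign_mean lu (f k) 0) * (2 * sign_mean lv (g k) 0) by ring.
  by apply: ler_pM; rewrite ?sqrtr_ge0//; apply: Khinchine;
     exact: euclidean_seminorm_ip.
rewrite -mulr_sumr; under eq_bigr do rewrite -sign_meanZ.
rewrite -sign_mean_sum.
apply: (@le_trans _ _ (4 * sign_mean lu (fun u =>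
    K / 2 * rnorm u ^+ 2 + K / 2 * \sum_(b <- lv) rnorm b ^+ 2) 0)); last first.
  rewrite sign_meanD !sign_meanZ sign_mean_cst sign_mean_sqr//.
  by rewrite rnorm0 expr0n add0r le_eqVlt; apply/orP; left; apply/eqP; field.
rewrite ler_pM2l//; apply: sign_mean_le => u.
apply: (@le_trans _ _ (sign_mean lv (fun v =>
    K / 2 * rnorm u ^+ 2 + K / 2 * rnorm v ^+ 2) 0)); last first.
  by rewrite sign_meanD !sign_meanZ sign_mean_cst sign_mean_sqr// rnorm0
    expr0n add0r.
under eq_bigr do rewrite mulrC -sign_meanZ.
rewrite -sign_mean_sum; apply: sign_mean_le => v.
apply: le_trans (xyK n u v) _.
rewrite -mulrDr -mulrA ler_wpM2l//.
by have := sqr_ge0 (rnorm u - rnorm v); lra.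
Qed.

(** The weight is the minimiser [(ln q - ln p) / 2]. The common lower bound [c] keeps the ratio of
    [p] and [q] between [rho^-1] and [rho], which confines it. *)
Lemma balancing_weight (p q c rho : R) : 0 < c ->
  c <= p <= rho * c -> c <= q <= rho * c ->
  exists2 w, - ln rho <= w <= ln rho &
    expR w * p + expR (- w) * q = 2 * (Num.sqrt p * Num.sqrt q).
Proof.
move=> c0 /andP[cp prho] /andP[cq qrho].
have p0 : 0 < p := lt_le_trans c0 cp.
have q0 : 0 < q := lt_le_trans c0 cq.
have rho1 : 1 <= rho by rewrite -(ler_pM2r c0) mul1r (le_trans cp).
have rho0 : 0 < rho := lt_le_trans ltr01 rho1.
have sqrtE (a : R) : 0 < a -> expR (ln a / 2) = Num.sqrt a.
  move=> a0; apply/eqP; rewrite -(@eqrXn2 _ 2)// ?expR_ge0 ?sqrtr_ge0//.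
  rewrite sqr_sqrtr ?(ltW a0)// expr2 -expRD.
  have -> : ln a / 2 + ln a / 2 = ln a by field.
  by rewrite lnK// posrE.
exists ((ln q - ln p) / 2).
  have : ln c <= ln p by rewrite ler_ln.
  have : ln c <= ln q by rewrite ler_ln.
  have : ln p <= ln rho + ln c.
    by rewrite -lnM ?posrE// ler_ln// posrE mulr_gt0.
  have : ln q <= ln rho + ln c.
    by rewrite -lnM ?posrE// ler_ln// posrE mulr_gt0.
  have : 0 <= ln rho by rewrite ln_ge0.
  lra.
have -> : (ln q - ln p) / 2 = ln q / 2 + - (ln p / 2) by ring.
rewrite opprD opprK !expRD !expRN !sqrtE//.
have sp : Num.sqrt p != 0 by rewrite gt_eqF// sqrtr_gt0.
have sq : Num.sqrt q != 0 by rewrite gt_eqF// sqrtr_gt0.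
move: (sqr_sqrtr (ltW p0)) (sqr_sqrtr (ltW q0)) sp sq.
set P := Num.sqrt p; set Q := Num.sqrt q => pE qE sp sq.
by rewrite -pE -qE; field; rewrite sp sq.
Qed.

Section Perturbation.

(* Adding [delta k] to both quadratic forms confines the optimal weight to an
   interval that does not depend on [u] and [v]; the decay of [delta] keeps the
   total cost of the perturbation bounded. *)
Let delta k := ((2^-1) ^+ k / (1 + rnorm (x k) + rnorm (y k))) ^+ 2.
Let mass k := rnorm (x k) ^+ 2 + rnorm (y k) ^+ 2.
Let radius k := ln ((mass k + delta k) / delta k).

Let denom_gt0 k : 0 < 1 + rnorm (x k) + rnorm (y k).
Proof. by rewrite !ltr_wpDr ?rnorm_ge0. Qed.

Let delta_gt0 k : 0 < delta k.
Proof. by rewrite exprn_gt0// divr_gt0// exprn_gt0// invr_gt0. Qed.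

Let sqrt_delta k :
  Num.sqrt (delta k) = (2^-1) ^+ k / (1 + rnorm (x k) + rnorm (y k)).
Proof.
by rewrite sqrtr_sqr ger0_norm// divr_ge0 ?exprn_ge0 ?invr_ge0 ?(ltW (denom_gt0 _)).
Qed.

Let half_le1 k : 0 <= (2^-1 : R) ^+ k <= 1.
Proof.
rewrite exprn_ge0 ?invr_ge0//= exprn_ile1// ?invr_ge0//.
by rewrite invf_le1// ler1n.
Qed.

Let sqrt_delta_le1 k : Num.sqrt (delta k) <= 1.
Proof.
have /andP[_ h1] := half_le1 k.
rewrite sqrt_delta ler_pdivrMr// mul1r (le_trans h1)//.
by rewrite -addrA lerDl addr_ge0 ?rnorm_ge0.
Qed.

(** Up to a factor [Lam], the left side is the cost of the perturbation at index [k]; the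
    denominator in [delta] is chosen to make it geometrically small. *)
Let sqrt_delta_le k :
  Num.sqrt (delta k) * (rnorm (x k) + rnorm (y k) + Num.sqrt (delta k)) <=
  2^-1 ^+ k.
Proof.
have -> : 2^-1 ^+ k =
    Num.sqrt (delta k) * (1 + rnorm (x k) + rnorm (y k)) :> R.
  by rewrite sqrt_delta divfK// gt_eqF.
by rewrite ler_wpM2l ?sqrtr_ge0//; have := sqrt_delta_le1 k; lra.
Qed.

Let sqrt_sum (a b : R) : 0 <= a -> 0 <= b ->
  Num.sqrt (a + b) <= Num.sqrt a + Num.sqrt b.
Proof.
move=> a0 b0; rewrite -(@ler_pXn2r _ 2)// ?nnegrE ?addr_ge0 ?sqrtr_ge0//.
rewrite sqr_sqrtr ?addr_ge0// sqrrD !sqr_sqrtr// -addrA lerD2l lerDr.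
by rewrite mulrn_wge0// mulr_ge0 ?sqrtr_ge0.
Qed.

(** Each [w k] balances the two perturbed forms at index [k]. Summing twice the geometric means
    costs [4 * K] through [square_function_bound], plus 4 from the geometric series of
    perturbations. *)
Lemma weighted_balance (lu lv : seq H) n :
  exists2 w : nat -> R, forall k, - radius k <= w k <= radius k &
  \sum_(0 <= k < n) (expR (w k) * (\sum_(a <- lu) rnorm (ip a (x k)) ^+ 2) +
                     expR (- w k) * (\sum_(b <- lv) rnorm (ip b (y k)) ^+ 2))
   <= (4 * K + 4) * (\sum_(a <- lu) rnorm a ^+ 2 + \sum_(b <- lv) rnorm b ^+ 2).
Proof.
set Lam := \sum_(a <- lu) _ + _.
pose P k := \sum_(a <- lu) rnorm (ip a (x k)) ^+ 2.
pose Q k := \sum_(b <- lv) rnorm (ip b (y k)) ^+ 2.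
have sum_ge0 (r : seq H) (F : H -> R) : 0 <= \sum_(a <- r) F a ^+ 2.
  by apply: sumr_ge0 => a _; exact: sqr_ge0.
have Lam0 : 0 <= Lam by rewrite addr_ge0.
have sq_le (r : seq H) z : \sum_(a <- r) rnorm (ip a z) ^+ 2 <=
    (\sum_(a <- r) rnorm a ^+ 2) * rnorm z ^+ 2.
  rewrite mulr_suml; apply: ler_sum => a _; rewrite -exprMn.
  rewrite ler_pXn2r ?nnegrE ?mulr_ge0 ?rnorm_ge0//.
  exact: Cauchy_Schwarz.
have PLam k : P k <= Lam * rnorm (x k) ^+ 2.
  by apply: le_trans (sq_le _ _) _; rewrite ler_wpM2r ?sqr_ge0// lerDl.
have QLam k : Q k <= Lam * rnorm (y k) ^+ 2.
  by apply: le_trans (sq_le _ _) _; rewrite ler_wpM2r ?sqr_ge0// lerDr.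
have P0 k : 0 <= P k by exact: sum_ge0.
have Q0 k : 0 <= Q k by exact: sum_ge0.
have Ld k : 0 <= Lam * delta k by rewrite mulr_ge0// ltW.
(* Both perturbed forms lie between [Lam * delta k] and this value. Their quotient is free of [Lam],
   so [radius] does not depend on the families. *)
have ratio k : (mass k + delta k) / delta k * (Lam * delta k) =
    Lam * rnorm (x k) ^+ 2 + Lam * rnorm (y k) ^+ 2 + Lam * delta k.
  by rewrite /mass; field; rewrite gt_eqF.
have rad0 k : 0 <= radius k.
  apply: ln_ge0; rewrite ler_pdivlMr// mul1r lerDr.
  by rewrite addr_ge0 ?sqr_ge0.
have balance k : exists w : R, - radius k <= w <= radius k /\
    expR w * P k + expR (- w) * Q k <=
    2 * (Num.sqrt (P k + Lam * delta k) * Num.sqrt (Q k + Lam * delta k)).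
  (* When [Lam = 0] the positive lower bound is lost, but both forms vanish and the weight 0
     serves. *)
  have [Lz|Lnz] := eqVneq Lam 0.
    have Pz : P k = 0.
      by apply/eqP; rewrite eq_le P0 andbT; have := PLam k; rewrite Lz mul0r.
    have Qz : Q k = 0.
      by apply/eqP; rewrite eq_le Q0 andbT; have := QLam k; rewrite Lz mul0r.
    exists 0; rewrite oppr_le0 rad0; split => //.
    by rewrite Pz Qz !mulr0 addr0 !mulr_ge0 ?sqrtr_ge0.
  have Lp : 0 < Lam by rewrite lt_def Lnz.
  have px : 0 <= Lam * rnorm (x k) ^+ 2 by rewrite mulr_ge0 ?sqr_ge0.
  have py : 0 <= Lam * rnorm (y k) ^+ 2 by rewrite mulr_ge0 ?sqr_ge0.
  have [|||w wr wE] := @balancing_weight (P k + Lam * delta k)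
      (Q k + Lam * delta k) (Lam * delta k) ((mass k + delta k) / delta k).
  - by rewrite mulr_gt0.
  - by rewrite ratio; have := P0 k; have := PLam k; lra.
  - by rewrite ratio; have := Q0 k; have := QLam k; lra.
  exists w; split => //; rewrite -wE.
  by apply: lerD; rewrite ler_pM2l ?expR_gt0// lerDl.
have [w wP] := choice balance; exists w => [k|]; first by have [] := wP k.
apply: (@le_trans _ _ (\sum_(0 <= k < n)
   (2 * (Num.sqrt (P k) * Num.sqrt (Q k)) + 2 * Lam * 2^-1 ^+ k))).
  apply: ler_sum => k _; have [_ /le_trans] := wP k; apply.
  rewrite -mulrA -mulrDr ler_pM2l//.
  have sL : Num.sqrt (Lam * delta k) = Num.sqrt Lam * Num.sqrt (delta k).
    by rewrite sqrtrM.
  have le_sqrtM z N : 0 <= z -> N <= Lam * z ^+ 2 ->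
      Num.sqrt N <= Num.sqrt Lam * z.
    move=> z0 NL; rewrite -[z]ger0_norm// -sqrtr_sqr -sqrtrM//.
    exact: ler_wsqrtr.
  have hP : Num.sqrt (P k) <= Num.sqrt Lam * rnorm (x k).
    by apply: le_sqrtM; rewrite ?rnorm_ge0.
  have hQ : Num.sqrt (Q k) <= Num.sqrt Lam * rnorm (y k).
    by apply: le_sqrtM; rewrite ?rnorm_ge0.
  set s := Num.sqrt (delta k) in sL *; set L := Num.sqrt Lam in sL hP hQ *.
  have LL : L * L = Lam by rewrite -expr2 sqr_sqrtr.
  have s0 : 0 <= s by exact: sqrtr_ge0.
  have L0 : 0 <= L by exact: sqrtr_ge0.
  apply: (@le_trans _ _ ((Num.sqrt (P k) + L * s) * (Num.sqrt (Q k) + L * s))).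
    by apply: ler_pM; rewrite ?sqrtr_ge0// -sL; apply: sqrt_sum.
  have h1 := ler_wpM2r (mulr_ge0 L0 s0) hP.
  have h2 := ler_wpM2r (mulr_ge0 L0 s0) hQ.
  have h3 := ler_wpM2l Lam0 (sqrt_delta_le k).
  rewrite -/s in h3.
  have -> : (Num.sqrt (P k) + L * s) * (Num.sqrt (Q k) + L * s) =
    Num.sqrt (P k) * Num.sqrt (Q k) + Num.sqrt (P k) * (L * s) +
    Num.sqrt (Q k) * (L * s) + (L * L) * (s * s) by ring.
  have E1 : L * rnorm (x k) * (L * s) = L * L * (rnorm (x k) * s) by ring.
  have E2 : L * rnorm (y k) * (L * s) = L * L * (rnorm (y k) * s) by ring.
  by rewrite LL in E1 E2 *; rewrite E1 in h1; rewrite E2 in h2; lra.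
rewrite big_split/= -!mulr_sumr.
have geo : \sum_(0 <= k < n) 2^-1 ^+ k <= 2 :> R.
  have -> : \sum_(0 <= k < n) 2^-1 ^+ k = 2 - 2 * 2^-1 ^+ n :> R.
    elim: n => [|m IH]; first by rewrite big_nil expr0; lra.
    by rewrite big_nat_recr//= IH exprS; lra.
  by have /andP[h _] := half_le1 n; lra.
have := square_function_bound lu lv n; rewrite -/Lam.
have := ler_wpM2l Lam0 geo; rewrite /P /Q.
set A := \sum_(0 <= k < n) _; set B := \sum_(0 <= k < n) _.
lra.
Qed.

(** Minimax over the product of the intervals given by [radius], compact by Tychonoff. The
    constraints are convex in [w] because [expR] is, and nonnegative combinations of them are
    covered by [weighted_balance]. *)
Lemma exists_weights : exists w : nat -> R, forall n u v,
  \sum_(0 <= k < n) (expR (w k) * rnorm (ip u (x k)) ^+ 2 +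
                     expR (- w k) * rnorm (ip v (y k)) ^+ 2)
   <= (4 * K + 4) * (rnorm u ^+ 2 + rnorm v ^+ 2).
Proof.
pose term (w : nat -> R) u v k := expR (w k) * rnorm (ip u (x k)) ^+ 2 +
  expR (- w k) * rnorm (ip v (y k)) ^+ 2.
pose f (i : nat * H * H) (w : {ptws nat -> R}) :=
  \sum_(0 <= k < i.1.1) term w i.1.2 i.2 k -
  (4 * K + 4) * (rnorm i.1.2 ^+ 2 + rnorm i.2 ^+ 2).
have term_ge0 w u v k : 0 <= term w u v k.
  by rewrite addr_ge0// mulr_ge0 ?expR_ge0 ?sqr_ge0.
have expR_conv (h a b : R) : 0 <= h <= 1 ->
    expR ((1 - h) * a + h * b) <= (1 - h) * expR a + h * expR b.
  move=> /andP[h0 h1]; set m := _ + h * b.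
  (* The exponential lies above its tangent at [m]; weighting this at [a] and [b] cancels the linear
     terms. *)
  have tangent c : expR m * (1 + (c - m)) <= expR c.
    have -> : expR c = expR m * expR (c - m).
      by rewrite -expRD; congr expR; ring.
    by rewrite ler_pM2l ?expR_gt0// expR_ge1Dx.
  have h1' : 0 <= 1 - h by lra.
  have := lerD (ler_wpM2l h1' (tangent a)) (ler_wpM2l h0 (tangent b)).
  by apply: le_trans; rewrite le_eqVlt /m; apply/orP; left; apply/eqP; ring.
pose T := [set w : {ptws nat -> R} | forall k, `[- radius k, radius k]%classic (w k)].
pose comb (h : R) (s t : {ptws nat -> R}) : {ptws nat -> R} :=
  fun k => (1 - h) * s k + h * t k.
have [|i|h s t h01 sT tT k|i h s t h01 _ _|l lam lam0|w _ wP] :=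
    @minimax R {ptws nat -> R} T comb _ f.
- exact: (@tychonoff nat (fun=> R) (fun k => `[- radius k, radius k]%classic)
    (fun k => @segment_compact R _ _)).
- have sum_continuous : continuous (fun w : {ptws nat -> R} =>
      \sum_(0 <= k < i.1.1) term w i.1.2 i.2 k).
    apply: (@continuous_sum_proj R (fun k a => expR a * rnorm (ip i.1.2 (x k)) ^+ 2
      + expR (- a) * rnorm (ip i.2 (y k)) ^+ 2)) => k.
    exact: continuous_expR_balance.
  move=> t; apply: (@continuousB R R {ptws nat -> R}
    (fun w => \sum_(0 <= k < i.1.1) term w i.1.2 i.2 k)
    (fun=> (4 * K + 4) * (rnorm i.1.2 ^+ 2 + rnorm i.2 ^+ 2))).
    exact: sum_continuous.
  exact: cst_continuous.
- have := sT k; have := tT k; rewrite /= !in_itv/= /comb => /andP[a1 a2] /andP[b1 b2].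
  have /andP[h0 h1] := h01; have h1' : 0 <= 1 - h by lra.
  have := lerD (ler_wpM2l h1' b1) (ler_wpM2l h0 a1).
  have := lerD (ler_wpM2l h1' b2) (ler_wpM2l h0 a2).
  by move=> u1 u2; apply/andP; split; lra.
- have -> : (1 - h) * f i s + h * f i t =
    \sum_(0 <= k < i.1.1) ((1 - h) * term s i.1.2 i.2 k + h * term t i.1.2 i.2 k)
    - (4 * K + 4) * (rnorm i.1.2 ^+ 2 + rnorm i.2 ^+ 2).
    by rewrite big_split/= -!mulr_sumr /f; ring.
  rewrite lerD2r; apply: ler_sum => k _; rewrite /term /comb.
  have e1 := ler_wpM2r (sqr_ge0 (rnorm (ip i.1.2 (x k)))) (expR_conv h (s k) (t k) h01).
  have e2 := ler_wpM2r (sqr_ge0 (rnorm (ip i.2 (y k)))) (expR_conv h (- s k) (- t k) h01).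
  have -> : - ((1 - h) * s k + h * t k) = (1 - h) * - s k + h * - t k by ring.
  apply: le_trans (lerD e1 e2) _.
  by rewrite le_eqVlt; apply/orP; left; apply/eqP; ring.
(* Multiplying vectors by [Num.sqrt (lam i)] multiplies their quadratic forms by [lam i], so the
   combination becomes one inequality for two finite families. *)
- pose lu := [seq (Num.sqrt (lam i))%:C *: i.1.2 | i <- l].
  pose lv := [seq (Num.sqrt (lam i))%:C *: i.2 | i <- l].
  (* The truncation lengths differ with [i]; extending all of them to the largest only adds
     nonnegative terms. *)
  pose N := \max_(i <- l) i.1.1.
  have [w wr wN] := weighted_balance lu lv N.
  exists w; first by move=> k; rewrite /= in_itv/= wr.
  have sq_lam i : Num.sqrt (lam i) ^+ 2 = lam i by rewrite sqr_sqrtr.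
  have scale i a z : rnorm (ip ((Num.sqrt (lam i))%:C *: a) z) ^+ 2 =
      lam i * rnorm (ip a z) ^+ 2.
    rewrite ipZl rnormM rnorm_real exprMn ger0_norm ?sqrtr_ge0//.
    by rewrite sq_lam.
  have scale' i a : rnorm ((Num.sqrt (lam i))%:C *: a) ^+ 2 = lam i * rnorm a ^+ 2.
    by rewrite rnormZ rnorm_real exprMn ger0_norm ?sqrtr_ge0// sq_lam.
  apply: (@le_trans _ _ (\sum_(i <- l) lam i *
      (\sum_(0 <= k < N) term w i.1.2 i.2 k -
       (4 * K + 4) * (rnorm i.1.2 ^+ 2 + rnorm i.2 ^+ 2)))).
    rewrite big_seq [X in _ <= X]big_seq; apply: ler_sum => i il.
    rewrite ler_wpM2l// lerD2r [X in _ <= X](big_cat_nat (n := i.1.1))//=.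
      by rewrite lerDl; apply: sumr_ge0.
    exact: (@leq_bigmax_seq _ l xpredT (fun i : nat * H * H => i.1.1)).
  have -> : \sum_(i <- l) lam i * (\sum_(0 <= k < N) term w i.1.2 i.2 k -
       (4 * K + 4) * (rnorm i.1.2 ^+ 2 + rnorm i.2 ^+ 2)) =
    \sum_(0 <= k < N) (expR (w k) * (\sum_(a <- lu) rnorm (ip a (x k)) ^+ 2) +
                     expR (- w k) * (\sum_(b <- lv) rnorm (ip b (y k)) ^+ 2)) -
    (4 * K + 4) * (\sum_(a <- lu) rnorm a ^+ 2 + \sum_(b <- lv) rnorm b ^+ 2).
    rewrite !big_map.
    under [LHS]eq_bigr do rewrite mulrBr.
    rewrite sumrB; congr (_ - _).
      under eq_bigr do rewrite mulr_sumr.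
      rewrite exchange_big/=; apply: eq_bigr => k _.
      rewrite !big_map !mulr_sumr -big_split/=; apply: eq_bigr => i _.
      by rewrite !scale /term; ring.
    rewrite -big_split/= mulr_sumr; apply: eq_bigr => i _.
    by rewrite !scale'; ring.
  by rewrite subr_le0.
exists w => n u v; have := wP (n, u, v).
by rewrite /f /= subr_le0.
Qed.

End Perturbation.

End Weights.

(** * From the Schauder frame to a pair of frames *)

Section ScaledFrames.
Variables (R : realType) (H : completeNormedModType R[i]).
Variable ip : {dot H for (@Num.conj R[i])}.
Hypothesis ip_norm : forall u : H, ip u u = `|u| ^+ 2.

(** Uniform boundedness is used twice: in [u] for fixed [v], starting from the absolute bounds on
    the pairings with [u], and then in [v], uniformly over [n] and normalised [u]. *)
Lemma schauder_bilinear_bound (x y : nat -> H) :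
  unconditional_schauder_frame ip x y ->
  exists2 K, 0 <= K & forall n u v,
    \sum_(0 <= k < n) rnorm (ip u (x k)) * rnorm (ip v (y k)) <=
    K * (rnorm u * rnorm v).
Proof.
move=> xyF; pose B n u v :=
  \sum_(0 <= k < n) rnorm (ip u (x k)) * rnorm (ip v (y k)).
have B_ge0 n u v : 0 <= B n u v.
  by apply: sumr_ge0 => k _; rewrite mulr_ge0 ?rnorm_ge0.
have Bl n u u' v : B n (u + u') v <= B n u v + B n u' v.
  rewrite -big_split/=; apply: ler_sum => k _.
  by rewrite -mulrDl ler_wpM2r ?rnorm_ge0// ipDl rnormD.
have Br n u v v' : B n u (v + v') <= B n u v + B n u v'.
  rewrite -big_split/=; apply: ler_sum => k _.
  by rewrite -mulrDr ler_wpM2l ?rnorm_ge0// ipDl rnormD.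
have BZl n (a : R) u v : B n (a%:C *: u) v = `|a| * B n u v.
  rewrite mulr_sumr; apply: eq_bigr => k _.
  by rewrite ipZl rnormM rnorm_real mulrA.
have BZr n (a : R) u v : B n u (a%:C *: v) = `|a| * B n u v.
  rewrite mulr_sumr; apply: eq_bigr => k _.
  by rewrite ipZl rnormM rnorm_real mulrCA.
have Bx n u v : B n u v <= (\sum_(0 <= k < n) rnorm (x k) * rnorm (ip v (y k))) * rnorm u.
  rewrite mulr_suml; apply: ler_sum => k _; rewrite mulrAC ler_wpM2r ?rnorm_ge0//.
  by rewrite mulrC; exact: Cauchy_Schwarz.
have By n u v : B n u v <= (\sum_(0 <= k < n) rnorm (ip u (x k)) * rnorm (y k)) * rnorm v.
  rewrite mulr_suml; apply: ler_sum => k _; rewrite -mulrA ler_wpM2l ?rnorm_ge0//.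
  by rewrite mulrC; exact: Cauchy_Schwarz.
have pointwise u v : exists M, forall n, B n u v <= M.
  have [uF _] := xyF v.
  have [M hM] := unconditionally_cvg_abs_bounded ip_norm u uF.
  exists M => n; apply: le_trans (hM n); apply: ler_sum => k _.
  by rewrite ipZl rnormM mulrC [rnorm (ip u _)](rnorm_ipC ip).
have separate v : exists2 K, 0 <= K & forall n u, B n u v <= K * rnorm u.
  apply: (@seminorm_uniform_bound R H nat (fun n u => B n u v)) => [n u u'|n a u|n|u].
  - exact: Bl.
  - exact: BZl.
  - by eexists => u; exact: Bx.
  - exact: pointwise.
have [||[n u]|v|K K0 hK] := @seminorm_uniform_bound R H (nat * H)
    (fun i v => (rnorm i.2)^-1 * B i.1 i.2 v).
- by move=> [n u] v v'; rewrite -mulrDr ler_wpM2l ?invr_ge0 ?rnorm_ge0//=; exact: Br.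
- by move=> [n u] a v /=; rewrite BZr mulrCA.
- exists ((rnorm u)^-1 * \sum_(0 <= k < n) rnorm (ip u (x k)) * rnorm (y k)) => v /=.
  by rewrite -mulrA ler_wpM2l ?invr_ge0 ?rnorm_ge0//; exact: By.
- have [K K0 hK] := separate v; exists K => -[n u] /=.
  (* For [u = 0] the convention [0^-1 = 0] makes the normalised seminorm vanish. *)
  have [u0|u0] := eqVneq (rnorm u) 0; first by rewrite u0 invr0 mul0r.
  rewrite mulrC ler_pdivrMr; first exact: hK.
  by rewrite lt_def u0 rnorm_ge0.
exists K => // n u v; have := hK (n, u) v; rewrite /= -/(B n u v).
have [u0|u0] := eqVneq (rnorm u) 0.
  by move=> _; have := Bx n u v; rewrite u0 mulr0 mul0r mulr0.
rewrite mulrC ler_pdivrMr; last by rewrite lt_def u0 rnorm_ge0.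
by rewrite -mulrA [rnorm v * _]mulrC.
Qed.

(** The weighted inequality [a * b <= C / 2 * a ^+ 2 + (2 * C)^-1 * b ^+ 2] and the upper bound for
    [z'] absorb half of [|u|^2], leaving the lower frame bound [C^-1] for [z]. *)
Lemma Bessel_pair_frame (z z' : nat -> H) (C : R) : 0 < C ->
  (forall n u, \sum_(0 <= k < n) rnorm (ip u (z k)) ^+ 2 <= C * rnorm u ^+ 2) ->
  (forall n u, \sum_(0 <= k < n) rnorm (ip u (z' k)) ^+ 2 <= C * rnorm u ^+ 2) ->
  (forall u e, 0 < e -> exists n, rnorm u ^+ 2 <=
     \sum_(0 <= k < n) rnorm (ip u (z k)) * rnorm (ip u (z' k)) + e) ->
  frame ip z.
Proof.
move=> C0 zC z'C recover; exists C^-1, C; rewrite invr_gt0; split=> // u.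
have term0 k : (0 <= (rnorm (ip u (z k)) ^+ 2)%:E)%E by rewrite lee_fin sqr_ge0.
split; last first.
  apply: lime_le; first exact: is_cvg_nneseries.
  by apply: nearW => n; rewrite sumEFin lee_fin.
apply/lee_addgt0Pr => e e0.
(* After the absorption and division by [C], this error becomes exactly [e]. *)
have Ce : 0 < C * e / 2 by rewrite divr_gt0// mulr_gt0.
have [n hn] := recover u _ Ce.
apply: (@le_trans _ _ (\sum_(0 <= k < n) (rnorm (ip u (z k)) ^+ 2)%:E + e%:E)%E); last first.
  by rewrite leeD2r//; apply: nneseries_lim_ge.
rewrite sumEFin -EFinD lee_fin ler_pdivrMl//.
set A := \sum_(0 <= k < n) _.
have : \sum_(0 <= k < n) rnorm (ip u (z k)) * rnorm (ip u (z' k)) <=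
    C / 2 * A + (2 * C)^-1 * \sum_(0 <= k < n) rnorm (ip u (z' k)) ^+ 2.
  rewrite !mulr_sumr -big_split; apply: ler_sum => k _ /=.
  set a := rnorm _; set b := rnorm _; rewrite -subr_ge0.
  have -> : C / 2 * a ^+ 2 + (2 * C)^-1 * b ^+ 2 - a * b =
      (2 * C)^-1 * (C * a - b) ^+ 2 by field; rewrite gt_eqF.
  by rewrite mulr_ge0 ?sqr_ge0// invr_ge0 mulr_ge0// ltW.
have : (2 * C)^-1 * \sum_(0 <= k < n) rnorm (ip u (z' k)) ^+ 2 <= rnorm u ^+ 2 / 2.
  have -> : rnorm u ^+ 2 / 2 = (2 * C)^-1 * (C * rnorm u ^+ 2).
    by field; rewrite gt_eqF.
  by rewrite ler_wpM2l// invr_ge0 mulr_ge0// ltW.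
by move: hn; lra.
Qed.

(** Pair [u = S + (u - S)] with [u], where [S] is a partial sum of the reconstruction series;
    Cauchy-Schwarz makes the remainder at most [e]. *)
Lemma schauder_recovery (x y : nat -> H) u (e : R) :
  unconditional_schauder_frame ip x y -> 0 < e ->
  exists n, rnorm u ^+ 2 <=
    \sum_(0 <= k < n) rnorm (ip u (x k)) * rnorm (ip u (y k)) + e.
Proof.
move=> /(_ u)[_ /cvgrPdist_lt cS] e0.
have v0 : 0 < 1 + rnorm u by rewrite ltr_pwDl// rnorm_ge0.
have d0 : 0 < (e / (1 + rnorm u))%:C :> R[i] by rewrite ltcR divr_gt0.
have [n _ /(_ n (leqnn n))] := cS _ d0.
rewrite /= rnormE ltcR => h; exists n.
have -> : rnorm u ^+ 2 = rnorm (ip u u).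
  by rewrite (ip_rnorm ip_norm) rnorm_real ger0_norm ?sqr_ge0.
set S := series _ n in h; rewrite -{1}[u](subrK S) addrC ipDl.
apply: le_trans (rnormD _ _) _; apply: lerD; last first.
  apply: le_trans (Cauchy_Schwarz ip_norm _ _) _.
  move: h; rewrite ltr_pdivlMr// mulrDr mulr1.
  by have := rnorm_ge0 (u - S); lra.
rewrite /S /series/= ip_suml; apply: le_trans (rnorm_sum _ _) _.
by apply: ler_sum => k _; rewrite ipZl rnormM mulrC (rnorm_ipC ip).
Qed.

End ScaledFrames.

Theorem theorem1p1 (R : realType) (H : completeNormedModType R[i])
    (ip : {dot H for (@Num.conj R[i])})
    (ip_norm : forall u : H, ip u u = `|u| ^+ 2)
    (sepH : separable H)
    (x y : nat -> H)
    (xy_frame : unconditional_schauder_frame ip x y) :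
  exists alpha : nat -> R[i],
    [/\ forall k, alpha k != 0,
        frame ip (fun k => alpha k *: x k) &
        frame ip (fun k => (Num.conj (alpha k))^-1 *: y k)].
Proof.
have [K K0 xyK] := schauder_bilinear_bound ip_norm xy_frame.
have [w wP] := exists_weights ip_norm K0 xyK.
(* Halving the exponent gives [alpha k] squared modulus [expR (w k)]. As [alpha k] is real and
   positive, its inverse conjugate carries the opposite weight. *)
pose alpha k := (expR (w k / 2))%:C.
have conj_inv k : (Num.conj (alpha k))^-1 = (expR (- w k / 2))%:C.
  by rewrite conj_real mulNr expRN fmorphV.
have alphaE (a : R) z u : rnorm (ip u ((expR a)%:C *: z)) = expR a * rnorm (ip u z).
  by rewrite ipZr rnormM conj_real rnorm_real ger0_norm ?expR_ge0.
have alphaE2 (a : R) z u : rnorm (ip u ((expR (a / 2))%:C *: z)) ^+ 2 =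
    expR a * rnorm (ip u z) ^+ 2.
  by rewrite alphaE exprMn expr2 -expRD -splitr.
have C0 : 0 < 4 * K + 4 by lra.
have xC n u : \sum_(0 <= k < n) rnorm (ip u (alpha k *: x k)) ^+ 2 <=
    (4 * K + 4) * rnorm u ^+ 2.
  (* Setting one of the two vectors to 0 in the joint estimate isolates the Bessel bound of one
     sequence. *)
  have := wP n u 0; rewrite rnorm0 expr0n/= addr0; apply: le_trans.
  by apply: ler_sum => k _; rewrite alphaE2 lerDl mulr_ge0 ?expR_ge0 ?sqr_ge0.
have yC n u : \sum_(0 <= k < n) rnorm (ip u ((Num.conj (alpha k))^-1 *: y k)) ^+ 2 <=
    (4 * K + 4) * rnorm u ^+ 2.
  have := wP n 0 u; rewrite rnorm0 expr0n/= add0r; apply: le_trans.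
  apply: ler_sum => k _; rewrite conj_inv alphaE2 lerDr.
  by rewrite mulr_ge0 ?expR_ge0 ?sqr_ge0.
(* The scalars cancel in the products, so the recovery estimate for [x] and [y] passes to the scaled
   sequences. *)
have prod u k : rnorm (ip u (alpha k *: x k)) *
    rnorm (ip u ((Num.conj (alpha k))^-1 *: y k)) =
    rnorm (ip u (x k)) * rnorm (ip u (y k)).
  by rewrite conj_inv !alphaE mulrACA -expRD mulNr subrr expR0 mul1r.
exists alpha; split => [k||].
- by rewrite fmorph_eq0 gt_eqF// expR_gt0.
- apply: (Bessel_pair_frame C0 xC yC) => u e e0.
  have [n hn] := schauder_recovery ip_norm u xy_frame e0; exists n.
  by under eq_bigr do rewrite prod.
- apply: (Bessel_pair_frame C0 yC xC) => u e e0.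
  have [n hn] := schauder_recovery ip_norm u xy_frame e0; exists n.
  by under eq_bigr do rewrite mulrC prod.
Qed.
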